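(* For every polynomial $p$ with real coefficients there exist a finite vector configuration $A=\{\mathbf a_1,\dots,\mathbf a_m\}\subseteq\mathbb N^n$ and a Markov basis $M$ of the toric ideal $I_A$ such that $|\mathcal C_A|>p(|M|)$, $|\mathcal U_A|>p(|M|)$ and $|Gr_A|>p(|M|)$. That is, the sizes of the Graver basis, of the universal Gröbner basis and of the set of circuits of a toric ideal cannot be bounded above by a polynomial in the size of a Markov basis of the ideal.
   Context: Let $\mathbb K$ be a field and $A=\{\mathbf a_1,\dots,\mathbf a_m\}$ a finite set of vectors in $\mathbb Z^n$. For $\mathbf u\in\mathbb N^m$ write $\mathbf x^{\mathbf u}=x_1^{u_1}\cdots x_m^{u_m}$ and $\deg_A(\mathbf x^{\mathbf u})=\sum_i u_i\mathbf a_i$. The toric ideal $I_A\subseteq\mathbb K[x_1,\dots,x_m]$ is the ideal generated by all binomials $\mathbf x^{\mathbf u}-\mathbf x^{\mathbf v}$ with $\deg_A(\mathbf x^{\mathbf u})=\deg_A(\mathbf x^{\mathbf v})$. An irreducible binomial $\mathbf x^{\mathbf u}-\mathbf x^{\mathbf v}\in I_A$ is primitive if there is no other binomial $\mathbf x^{\mathbf w}-\mathbf x^{\mathbf z}\in I_A$ with $\mathbf x^{\mathbf w}\mid\mathbf x^{\mathbf u}$ and $\mathbf x^{\mathbf z}\mid\mathbf x^{\mathbf v}$; the Graver basis $Gr_A$ is the set of primitive binomials. The universal Gröbner basis $\mathcal U_A$ is the union of the reduced Gröbner bases of $I_A$ over all term orders. The support of a binomial is the set of indices of variables occurring in it; a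 circuit is an irreducible nonzero binomial of $I_A$ with minimal support, and $\mathcal C_A$ is the set of circuits. A Markov basis of $I_A$ is a generating set of $I_A$ consisting of binomials that is minimal with respect to inclusion. (Binomials are considered up to sign.) *)

(* Defs.v *)
From mathcomp Require Import all_boot all_order all_algebra.
From mathcomp Require Import reals.
From mathcomp Require Import mpoly.

Set Implicit Arguments.
Unset Strict Implicit.
Unset Printing Implicit Defensive.

Import Order.TTheory GRing.Theory Num.Theory.
Local Open Scope ring_scope.

Definition irreducible_elt (S : unitRingType) (f : S) : Prop :=
  [/\ f != 0, f \isn't a GRing.unit
    & forall g h : S, f = g * h -> g \is a GRing.unit \/ h \is a GRing.unit].

Section Polynomials.
Variables (K : fieldType) (m : nat).
Implicit Types (f g : {mpoly K[m]}) (u v w z : 'X_{1..m}).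

Definition ideal_gen (G : {mpoly K[m]} -> Prop) f : Prop :=
  exists s : seq ({mpoly K[m]} * {mpoly K[m]}),
    (forall cg, cg \in s -> G cg.2) /\ f = \sum_(cg <- s) cg.1 * cg.2.

Definition binom u v : {mpoly K[m]} := 'X_[u] - 'X_[v].

Definition is_binomial f : Prop := exists u v, u != v /\ f = binom u v.

Definition psupp f : {set 'I_m} :=
  [set i | has (fun u : 'X_{1..m} => u i != 0%N) (msupp f)].

Definition term_order (le : rel 'X_{1..m}) : Prop :=
  [/\ total le, antisymmetric le, transitive le,
      forall u, le 0%MM u
    & forall u v w, le u v -> le (u + w)%MM (v + w)%MM].

Definition lead_mon (le : rel 'X_{1..m}) f u : Prop :=
  u \in msupp f /\ forall v, v \in msupp f -> le v u.

Definition initial_ideal (le : rel 'X_{1..m}) (S : {mpoly K[m]} -> Prop) :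
    {mpoly K[m]} -> Prop :=
  ideal_gen (fun h => exists f u, [/\ S f, lead_mon le f u & h = 'X_[u]]).

(* Finite sets of polynomials are given by lists; only membership in the list
   [G] matters here. *)
Definition groebner_basis (le : rel 'X_{1..m}) (I : {mpoly K[m]} -> Prop)
    (G : seq {mpoly K[m]}) : Prop :=
  (forall g, g \in G -> I g) /\
  (forall f, initial_ideal le (fun g => g \in G) f <-> initial_ideal le I f).

Definition reduced_groebner_basis (le : rel 'X_{1..m})
    (I : {mpoly K[m]} -> Prop) (G : seq {mpoly K[m]}) : Prop :=
  [/\ groebner_basis le I G,
      forall g, g \in G -> exists2 u, lead_mon le g u & g@_u = 1
    & forall g h u v, g \in G -> h \in G -> h != g -> lead_mon le h u ->
        v \in msupp g -> ~~ (u <= v)%MM].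

End Polynomials.

Section Toric.
Variables (K : fieldType) (n m : nat) (a : 'I_m -> 'rV[int]_n).
Implicit Types (f g : {mpoly K[m]}) (u v w z : 'X_{1..m}).

Definition degA u : 'rV[int]_n := \sum_(i < m) a i *+ u i.

Definition toric_ideal : {mpoly K[m]} -> Prop :=
  ideal_gen (fun f => exists u v, degA u = degA v /\ f = binom K u v).

(* [w != z] keeps out the zero binomial: with [w = z = 0] both divisibility
   conditions would always hold. *)
Definition primitive u v : Prop :=
  [/\ irreducible_elt (binom K u v), toric_ideal (binom K u v)
    & forall w z, w != z -> toric_ideal (binom K w z) ->
        (w <= u)%MM -> (z <= v)%MM -> binom K w z = binom K u v].

Definition graver_basis f : Prop :=
  exists u v, primitive u v /\ f = binom K u v.

Definition universal_groebner_basis f : Prop :=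
  exists le G, [/\ term_order le,
    reduced_groebner_basis le toric_ideal G & f \in G].

Definition circuit f : Prop :=
  [/\ is_binomial f, irreducible_elt f, toric_ideal f
    & forall g, is_binomial g -> toric_ideal g -> ~~ (psupp g \proper psupp f)].

(* As [M] is duplicate-free, its cardinality is [size M].  Minimality rules
   out that [M] contains both a binomial and its opposite. *)
Definition markov_basis (M : seq {mpoly K[m]}) : Prop :=
  [/\ uniq M,
      forall f, f \in M -> is_binomial f,
      forall f, ideal_gen (fun g => g \in M) f <-> toric_ideal f
    & forall S : seq {mpoly K[m]}, {subset S <= M} ->
        (forall f, ideal_gen (fun g => g \in S) f <-> toric_ideal f) ->
        {subset M <= S}].

End Toric.

(* The cardinality of [S], with polynomials identified up to sign, is larger
   than the real number [r]: [S] has more than [r] elements that are pairwise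
   distinct up to sign. *)
Definition card_up_to_sign_gt (R : realType) (V : zmodType) (S : V -> Prop)
    (r : R) : Prop :=
  exists s : seq V,
    [/\ forall f, f \in s -> S f,
        pairwise (fun f g => (f != g) && (f != - g)) s
      & r < (size s)%:R].

(* Main.v *)
(* Take the generators d_i = 2 e_i, f_i = 3 e_i (i < N) and t = (6, ..., 6) in
   N^N.  The N + 1 binomials f_i^2 - d_i^3 and t - prod_i d_i^3 form a Markov
   basis.  In the last one, each d_i^3 may be replaced independently by f_i^2:
   this gives 2^N binomials t - (product over S of the d_i^3) (product off S of
   the f_i^2).  They are irreducible because they are linear in t, and they are
   primitive and circuits by inspection of degrees.  For the term orders that
   give weight 1 to t, to f_i for i in S and to d_i for i not in S, such a
   binomial and the f_i^2 - d_i^3 form a reduced Groebner basis: a monomial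
   divisible by no leading monomial has minimal weight in its fibre, and is the
   only one of that weight. *)
Require Import Defs.
From mathcomp Require Import all_boot all_order all_algebra.
From mathcomp Require Import reals.
From mathcomp Require Import mpoly.
From mathcomp Require Import zify.

Set Implicit Arguments.
Unset Strict Implicit.
Unset Printing Implicit Defensive.

Import Order.TTheory GRing.Theory Num.Theory.
Local Open Scope ring_scope.

(** * Ideals given by generators *)

Section Ideals.
Variables (K : fieldType) (m : nat).
Implicit Types (f g : {mpoly K[m]}) (G H : {mpoly K[m]} -> Prop).

Lemma ideal_gen_base G f : G f -> ideal_gen G f.
Proof.
move=> Gf; exists [:: (1, f)]; split; last by rewrite big_seq1 mul1r.
by move=> cg; rewrite inE => /eqP->.
Qed.

Lemma ideal_gen0 G : ideal_gen G 0.
Proof. by exists [::]; split => //; rewrite big_nil. Qed.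

Lemma ideal_genD G f g : ideal_gen G f -> ideal_gen G g -> ideal_gen G (f + g).
Proof.
move=> [s [Gs ->]] [r [Gr ->]]; exists (s ++ r); split; last by rewrite big_cat.
by move=> cg; rewrite mem_cat => /orP[/Gs|/Gr].
Qed.

Lemma ideal_genMl G c f : ideal_gen G f -> ideal_gen G (c * f).
Proof.
move=> [s [Gs ->]]; exists [seq (c * cg.1, cg.2) | cg <- s]; split.
  by move=> cg /mapP[dg /Gs Gdg ->].
by rewrite big_map mulr_sumr; apply: eq_bigr => cg _; rewrite /= mulrA.
Qed.

Lemma ideal_genN G f : ideal_gen G f -> ideal_gen G (- f).
Proof. by rewrite -mulN1r; apply: ideal_genMl. Qed.

Lemma ideal_gen_sub G H f :
  (forall g, G g -> ideal_gen H g) -> ideal_gen G f -> ideal_gen H f.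
Proof.
move=> GH [s [Gs ->]]; elim: s Gs => [|cg s IHs] Gs.
  by rewrite big_nil; apply: ideal_gen0.
rewrite big_cons; apply: ideal_genD.
  by apply/ideal_genMl/GH/Gs; rewrite mem_head.
by apply: IHs => dg sdg; apply: Gs; rewrite inE sdg orbT.
Qed.

Lemma ideal_gen_ker (S : nzRingType) (phi : {rmorphism {mpoly K[m]} -> S}) G f :
  (forall g, G g -> phi g = 0) -> ideal_gen G f -> phi f = 0.
Proof.
move=> G0 [s [Gs ->]]; rewrite rmorph_sum big_seq big1 // => cg /Gs /G0 phi0.
by rewrite rmorphM /= phi0 mulr0.
Qed.

End Ideals.

(** * Binomials: supports, evaluation, irreducibility *)

Section Binomials.
Variables (K : fieldType) (m : nat).
Implicit Types (u v w : 'X_{1..m}).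

Lemma mem_msupp_binom u v w :
  u != v -> (w \in msupp (binom K u v)) = (w == u) || (w == v).
Proof.
move=> neq_uv; rewrite mcoeff_msupp mcoeffB !mcoeffX ![w == _]eq_sym.
case: (eqVneq u w) => [<-|_]; last first.
  by rewrite sub0r oppr_eq0; case: (v == w); rewrite ?oner_eq0 ?eqxx.
by rewrite [v == u]eq_sym (negbTE neq_uv) subr0 oner_eq0.
Qed.

Lemma mem_psupp_binom u v j :
  u != v -> (j \in psupp (binom K u v)) = (u j != 0%N) || (v j != 0%N).
Proof.
move=> neq_uv; rewrite inE; apply/hasP/orP => [[w]|].
  by rewrite mem_msupp_binom // => /orP[]/eqP-> ?; [left|right].
by case=> ?; [exists u|exists v] => //; rewrite mem_msupp_binom // eqxx ?orbT.
Qed.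

Lemma meval_indicator (Z : {set 'I_m}) u :
  ('X_[u] : {mpoly K[m]}).@[fun j => (j \notin Z)%:R]
    = [forall j in Z, u j == 0%N]%:R.
Proof.
rewrite mevalX; case: (boolP [forall j in Z, u j == 0%N]) => [/forall_inP u0|].
  rewrite big1 // => j _; case: (boolP (j \in Z)) => [/u0/eqP->|_] //=.
  by rewrite expr1n.
rewrite negb_forall_in => /exists_inP[j Zj uj]; rewrite (bigD1 j) //=.
by rewrite Zj expr0n (negbTE uj) mul0r.
Qed.

(* Being monic of degree one in the variable [t], it can only factor through
   a constant. *)
Lemma irreducible_binom_linear (t : 'I_m) v :
  v t = 0%N -> irreducible_elt (binom K U_(t) v).
Proof.
move=> vt0.
(* [phi] reads a polynomial as one in the single variable [t], sent to ['X]; substituting ['X_t] for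
   ['X] undoes it. *)
pose h j : {poly {mpoly K[m]}} := if j == t then 'X else ('X_j)%:P.
pose phi : {rmorphism {mpoly K[m]} -> {poly {mpoly K[m]}}} :=
  mmap (polyC \o @mpolyC m K) h.
have phiX u : u t = 0%N -> phi 'X_[u] = ('X_[u])%:P.
  move=> ut0; rewrite /= mmapX mpolyXE_id rmorph_prod; apply: eq_bigr => j _.
  rewrite /h; case: eqP => [->|_]; first by rewrite ut0 !expr0.
  by rewrite rmorphXn.
have phiK g : (phi g).['X_t] = g.
  pose ev : {rmorphism {mpoly K[m]} -> {mpoly K[m]}} :=
    horner_eval ('X_t : {mpoly K[m]}) \o phi.
  rewrite -[LHS]/(ev g) [in LHS](mpolyE g) [RHS]mpolyE rmorph_sum.
  apply: eq_bigr => u _; rewrite -!mul_mpolyC rmorphM /=; congr (_ * _).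
    by rewrite /horner_eval mmapC hornerC.
  rewrite /horner_eval mmapX /mmap1 horner_prod [RHS]mpolyXE_id.
  apply: eq_bigr => j _; rewrite horner_exp /h.
  by case: eqP => [->|_]; rewrite ?hornerX ?hornerC.
have phif : phi (binom K U_(t) v) = 'X - ('X_[v])%:P.
  by rewrite rmorphB (phiX v) // /phi /= mmapX mmap1U /h eqxx.
have {h phi phiX phif phiK} [phi phif phiK] :
    exists2 phi : {rmorphism {mpoly K[m]} -> {poly {mpoly K[m]}}},
    phi (binom K U_(t) v) = 'X - ('X_[v])%:P & forall g, (phi g).['X_t] = g.
  by exists phi.
(* The coefficient of degree one in the product is 1, so it exhibits an inverse of a constant
   factor. *)
have constU g k : binom K U_(t) v = g * k -> (size (phi g) <= 1)%N ->
    g \is a GRing.unit.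
  move=> fE /size1_polyC gE; have := congr1 phi fE.
  rewrite phif rmorphM [phi g]gE => /(congr1 (fun q : {poly _} => q`_1)).
  rewrite coefB coefX coefC subr0 coefCM => /esym gk1.
  rewrite -[g]phiK gE hornerC; apply/unitrPr; by eexists; apply: gk1.
have sz2 : size ('X - ('X_[v] : {mpoly K[m]})%:P) = 2%N by rewrite size_XsubC.
split.
- by apply/eqP => f0; have := sz2; rewrite -phif f0 rmorph0 size_poly0.
- apply/negP => fU; have := rmorph_unit phi fU; by rewrite phif poly_unitE sz2.
move=> g k fE; have := congr1 phi fE.
rewrite phif rmorphM => /(congr1 (fun q : {poly {mpoly K[m]}} => size q)).
rewrite sz2 => sz.
have [g0|gn0] := eqVneq (phi g) 0.
  by move: sz; rewrite g0 mul0r size_poly0.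
have [k0|kn0] := eqVneq (phi k) 0.
  by move: sz; rewrite k0 mulr0 size_poly0.
move: sz; rewrite size_mul //= => sz.
have [le1|gt1] := leqP (size (phi g)) 1%N; [left|right].
  exact: (constU g k).
apply: (constU k g); first by rewrite mulrC.
move: sz gt1; move: (size (phi g)) (size (phi k)) => x y; lia.
Qed.

End Binomials.

(** * Term orders refining a weight *)

Section WeightOrder.
Variables (m : nat) (W : 'X_{1..m} -> nat).
Implicit Types u v w : 'X_{1..m}.
Hypothesis WD : forall u v, W (u + v)%MM = (W u + W v)%N.

Definition weight_order : rel 'X_{1..m} :=
  fun u v => ((W u < W v) || ((W u == W v) && (u <= v)%O))%N.

Lemma weight_order_term_order : term_order weight_order.
Proof.
have W0 : W 0%MM = 0%N by have := WD 0%MM 0%MM; rewrite addm0; lia.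
split.
- move=> u v; rewrite /weight_order; case: ltngtP => //= _.
  exact: le_total.
- move=> u v; rewrite /weight_order; case: ltngtP => //= _.
  exact: le_anti.
- move=> v u w; rewrite /weight_order.
  case: (ltngtP (W u) (W v)) => //= [uv|->]; last first.
    by case: ltngtP => //= _; apply: le_trans.
  by case: (ltngtP (W v) (W w)) => //= [vw _ _|<-];
    rewrite ?(ltn_trans uv vw) ?uv.
- by move=> u; rewrite /weight_order W0 le0x andbT orbC -leq_eqVlt.
- move=> u v w; rewrite /weight_order !WD ltn_add2r eqn_add2r.
  by rewrite lemc_add2l.
Qed.

End WeightOrder.

(** * The configuration and its variables *)

Section Configuration.
Variables (K : fieldType) (N : nat).

Notation T := (option ('I_N * bool)).
Notation m := #|{: T}|.
Implicit Types (u v w : 'X_{1..m}) (f g h : {mpoly K[m]}).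
Implicit Types (S : {set 'I_N}) (k : option 'I_N).

Definition slot_exp (b : bool) : nat := if b then 2 else 3.

(* [var i false], [var i true] and [tvar] are d_i, f_i and t; note that
   [slot_exp b] copies of [var i b] have degree 6 e_i. *)
Definition var i b : 'I_m := enum_rank (Some (i, b) : T).
Definition tvar : 'I_m := enum_rank (None : T).

Definition wt (s : T) (i : 'I_N) : nat :=
  if s is Some (j, b) then (j == i) * slot_exp (~~ b) else 6.

Definition conf (j : 'I_m) : 'rV[int]_N := \row_i (wt (enum_val j) i)%:Z.

Lemma eq_var i b j c : (var i b == var j c) = (i == j) && (b == c).
Proof. by rewrite /var (inj_eq enum_rank_inj). Qed.

Lemma eq_tvar_var i b : (tvar == var i b) = false.
Proof. by rewrite /tvar /var (inj_eq enum_rank_inj). Qed.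

Lemma eq_var_tvar i b : (var i b == tvar) = false.
Proof. by rewrite eq_sym eq_tvar_var. Qed.

Lemma conf_ge0 i j : 0 <= conf i 0 j.
Proof. by rewrite mxE. Qed.

Lemma conf_inj : injective conf.
Proof.
move=> j j' /rowP eq_wt; apply: enum_val_inj.
have {}eq_wt i : wt (enum_val j) i = wt (enum_val j') i.
  by have := eq_wt i; rewrite !mxE => -[].
case: (enum_val j) (enum_val j') eq_wt => [[i b]|] [[i' b']|] //= eq_wt.
- have := eq_wt i; rewrite eqxx; case: eqP => [->|_]; last by case: b {eq_wt}.
  by case: b b' {eq_wt} => [] [].
- by have := eq_wt i; rewrite eqxx; case: b {eq_wt}.
- by have := eq_wt i'; rewrite eqxx; case: b' {eq_wt}.
Qed.

Definition mon (F : T -> nat) : 'X_{1..m} := [multinom F (enum_val j) | j < m].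

Lemma mon_var F i b : mon F (var i b) = F (Some (i, b)).
Proof. by rewrite mnmE enum_rankK. Qed.

Lemma mon_tvar F : mon F tvar = F None.
Proof. by rewrite mnmE enum_rankK. Qed.

Lemma var_ind (P : 'I_m -> Prop) :
  P tvar -> (forall i b, P (var i b)) -> forall j, P j.
Proof.
by move=> Pt Pv j; rewrite -[j]enum_valK; case: (enum_val j) => [[]|].
Qed.

Lemma eq_mnm_var u v :
  u tvar = v tvar -> (forall i b, u (var i b) = v (var i b)) -> u = v.
Proof. by move=> eqt eqv; apply/mnmP; apply: var_ind. Qed.

Lemma lem_var u v :
  (u <= v)%MM -> (u tvar <= v tvar)%N /\
    forall i b, (u (var i b) <= v (var i b))%N.
Proof. by move=> /mnm_lepP le_uv; split => [|i b]; apply: le_uv. Qed.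

(** * Degrees and the toric ideal *)

Definition deg u : 'X_{1..N} :=
  (\sum_j [multinom wt (enum_val j) i | i < N] *+ u j)%MM.

Lemma degE u i :
  deg u i = (6 * u tvar + 2 * u (var i false) + 3 * u (var i true))%N.
Proof.
rewrite mnm_sumE (bigD1 tvar) //= (bigD1 (var i false)) ?eq_var_tvar //=.
rewrite (bigD1 (var i true)) ?eq_var_tvar ?eq_var ?andbF //=.
rewrite !mulmnE !mnmE !enum_rankK /= eqxx /= big1 ?addn0 ?addnA // => j.
elim/var_ind: j => [|j b]; rewrite ?eqxx //.
rewrite eq_var_tvar !eq_var mulmnE mnmE enum_rankK /=.
by case: eqP => //= _; case: b.
Qed.

Lemma deg_eq u v : deg u = deg v -> forall i,
  (6 * u tvar + 2 * u (var i false) + 3 * u (var i true)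
    = 6 * v tvar + 2 * v (var i false) + 3 * v (var i true))%N.
Proof. by move=> /mnmP eq_deg i; rewrite -!degE. Qed.

Lemma degAE u i : degA conf u 0 i = (deg u i)%:Z.
Proof.
rewrite summxE mnm_sumE -[RHS]natz natr_sum.
by apply: eq_bigr => j _; rewrite mulmnE mulmxnE !mxE mnmE mulrnA natz.
Qed.

Lemma degA_deg u v : degA conf u = degA conf v <-> deg u = deg v.
Proof.
split=> [eqA|eqd]; last by apply/rowP => i; rewrite !degAE eqd.
by apply/mnmP => i; have := congr1 (fun x : 'rV_N => x 0 i) eqA;
  rewrite /= !degAE => -[].
Qed.

Lemma degD u v : deg (u + v)%MM = (deg u + deg v)%MM.
Proof. by apply/mnmP => i; rewrite mnmDE !degE !mnmDE; lia. Qed.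

Let IA := toric_ideal (K := K) conf.

(** The monomial parametrization attached to [conf]; it vanishes on [IA]. *)
Definition phi : {rmorphism {mpoly K[m]} -> {mpoly K[N]}} :=
  mmap (@mpolyC N K) (fun j => 'X_[ [multinom wt (enum_val j) i | i < N] ]).

Lemma phiX u : phi 'X_[u] = 'X_[deg u].
Proof.
rewrite /phi /= mmapX /mmap1 /deg.
rewrite (big_morph (fun d => 'X_[d] : {mpoly K[N]})
  (@mpolyXD _ _) (@mpolyX0 _ _)).
by apply: eq_bigr => j _; rewrite mpolyXn.
Qed.

Lemma toric_phi f : IA f -> phi f = 0.
Proof.
apply: ideal_gen_ker => g [u [v [/degA_deg eq_uv ->]]].
by rewrite rmorphB !phiX eq_uv subrr.
Qed.

(** A binomial in [IA] is killed by [phi], and distinct monomials have distinct supports, so its two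
    degrees agree. *)
Lemma toric_binom u v : IA (binom K u v) <-> deg u = deg v.
Proof.
split=> [/toric_phi/eqP|/degA_deg eq_uv]; last first.
  by apply: ideal_gen_base; exists u, v.
by rewrite rmorphB !phiX subr_eq0 => /eqP/(congr1 (@msupp _ _));
  rewrite !msuppX => -[].
Qed.

(* The product of the [d_i^3] for [i] in [S] and the [f_i^2] for [i] off [S]. *)
Definition tail S : 'X_{1..m} :=
  mon (fun s =>
    if s is Some (i, b) then (b == (i \notin S)) * slot_exp b else 0)%N.

(* The leading monomials are powers of the variables of weight 1; [None] stands
   for the binomial with leading monomial [t], and [Some i] for the one in
   [d_i] and [f_i]. *)
Definition lvar S k : 'I_m := if k is Some i then var i (i \in S) else tvar.
Definition lexp S k : nat := if k is Some i then slot_exp (i \in S) else 1.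
Definition lm S k : 'X_{1..m} := (U_(lvar S k) *+ lexp S k)%MM.
Definition tm S k : 'X_{1..m} :=
  if k is Some i then (U_(var i (i \notin S)) *+ slot_exp (i \notin S))%MM
  else tail S.
Definition gen S k := binom K (lm S k) (tm S k).
Definition gens S := [seq gen S k | k : option 'I_N].

Lemma tail_var S i b : tail S (var i b) = ((b == (i \notin S)) * slot_exp b)%N.
Proof. exact: mon_var. Qed.

Lemma tail_tvar S : tail S tvar = 0%N.
Proof. exact: mon_tvar. Qed.

Lemma lexp_gt0 S k : (0 < lexp S k)%N.
Proof. by case: k => //= i; case: (i \in S). Qed.

Lemma lvar_inj S : injective (lvar S).
Proof.
move=> [i|] [j|] //= /eqP; rewrite ?eq_var ?eq_var_tvar ?eq_tvar_var //.
by case/andP => /eqP->.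
Qed.

(** Tails avoid all variables of leading monomials: both the drop of weight under reduction and the
    reducedness of the basis rest on this. *)
Lemma tm_lvar S k k' : tm S k (lvar S k') = 0%N.
Proof.
case: k k' => [i|] [j|] /=; rewrite ?mulmnE ?mnm1E ?tail_var ?tail_tvar //.
- by rewrite eq_var; case: eqP => [->|//]; case: (j \in S).
- by rewrite eq_var_tvar.
- by case: (j \in S).
Qed.

Lemma lm_lvar S k k' : lm S k (lvar S k') = ((k == k') * lexp S k)%N.
Proof. by rewrite mulmnE mnm1E (inj_eq (@lvar_inj S)). Qed.

Lemma lm_neq_tm S k : lm S k != tm S k.
Proof.
apply/eqP => /(congr1 (fun u : 'X_{1..m} => u (lvar S k))).
by rewrite tm_lvar lm_lvar eqxx; have := lexp_gt0 S k; lia.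
Qed.

Lemma lm_dvd S k u : (lm S k <= u)%MM = (lexp S k <= u (lvar S k))%N.
Proof.
apply/mnm_lepP/idP => [/(_ (lvar S k))|le_u j].
  by rewrite lm_lvar eqxx mul1n.
by rewrite mulmnE mnm1E; case: eqP => [<-|//]; rewrite mul1n.
Qed.

Lemma deg_lm_tm S k : deg (lm S k) = deg (tm S k).
Proof.
apply/mnmP => i; rewrite !degE.
case: k => [j|]; rewrite !mulmnE !mnm1E /= ?tail_var ?tail_tvar.
  by rewrite !eq_var !eq_var_tvar;
    case: eqP => [->|]; case: (_ \in _).
by rewrite !eq_tvar_var eqxx; case: (_ \in _).
Qed.

Lemma gen_toric S k : IA (gen S k).
Proof. exact/toric_binom/deg_lm_tm. Qed.

(** * Standard monomials, Groebner bases and Markov bases *)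

Definition weight S u : nat := \sum_k u (lvar S k).

Lemma weightD S u v : weight S (u + v)%MM = (weight S u + weight S v)%N.
Proof. by rewrite -big_split; apply: eq_bigr => k _; rewrite mnmDE. Qed.

Definition le_wt S := weight_order (weight S).

Lemma weight_tm S k : weight S (tm S k) = 0%N.
Proof. by apply: big1 => k' _; apply: tm_lvar. Qed.

Lemma weight_lm S k : (0 < weight S (lm S k))%N.
Proof.
by rewrite /weight (bigD1 k) //= lm_lvar eqxx mul1n ltn_addr // lexp_gt0.
Qed.

(* Along [2 a + 3 b], the value of [b] modulo 2 and that of [a] modulo 3 are
   determined, so the reduced exponents of a standard monomial are minimal. *)
Lemma standard_min S u v :
  (forall k, ~~ (lm S k <= u)%MM) -> deg u = deg v -> le_wt S u v.
Proof.
move=> std_u /deg_eq eq_deg.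
have {}std_u k : (u (lvar S k) < lexp S k)%N by rewrite ltnNge -lm_dvd.
(* [u] does not contain [t], and [6 * v tvar] is zero modulo 2 and 3, so the residues fixed by [u]
   carry over to [v]. *)
have le_uv k : (u (lvar S k) <= v (lvar S k))%N.
  have := std_u None; case: k => [i|] /=; last by lia.
  have := std_u (Some i); have := eq_deg i.
  by rewrite /= /slot_exp; case: (i \in S); lia.
have [le_W eq_W] : (weight S u <= weight S v ?= iff
    [forall k, u (lvar S k) == v (lvar S k)])%N.
  by apply: leqif_sum => k _; split.
rewrite /le_wt /weight_order ltn_neqAle le_W eq_W andbT.
(* With equal weights, [u] and [v] agree on the leading variables, and the degree fixes the other
   exponents. *)
case: forallP => //= eq_uv.
rewrite [u](_ : _ = v) ?lexx //; have eq_t := eqP (eq_uv None).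
apply: eq_mnm_var => // i b; have := eqP (eq_uv (Some i)).
by have := eq_deg i; move: eq_t => /=; case: (i \in S); case: b; lia.
Qed.

Lemma mem_gens S f : reflect (exists k, f = gen S k) (f \in gens S).
Proof. exact: codomP. Qed.

(** Replacing a leading monomial by its tail keeps the degree and lowers the weight, so division
    terminates. *)
Lemma standard_reduction S u :
  exists2 v, forall k, ~~ (lm S k <= v)%MM
           & deg u = deg v /\ ideal_gen (fun f => f \in gens S) (binom K u v).
Proof.
have [n] := ubnP (weight S u); elim: n u => // n IHn u leWn.
have [/existsP[k lm_u]|] := boolP [exists k, (lm S k <= u)%MM]; last first.
  rewrite negb_exists => /forallP std_u; exists u => //; split=> //.
  by rewrite /binom subrr; apply: ideal_gen0.
have uE := submK lm_u; set w := (u - lm S k)%MM in uE.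
have [|v std_v [eq_deg uv]] := IHn (w + tm S k)%MM.
  have := weight_lm S k; move: leWn; rewrite -uE !weightD weight_tm; lia.
exists v => //; rewrite -eq_deg -uE; split; first by rewrite !degD deg_lm_tm.
have -> : binom K (w + lm S k) v = 'X_[w] * gen S k + binom K (w + tm S k) v.
  by rewrite /gen /binom mulrBr -!mpolyXD addrA subrK.
by apply: ideal_genD => //; apply/ideal_genMl/ideal_gen_base/mem_gens; exists k.
Qed.

Lemma le_wt_term_order S : term_order (le_wt S).
Proof. exact/weight_order_term_order/weightD. Qed.

(** Standard monomials of equal degree are each below the other, hence equal: monomials in one fibre
    have the same normal form. *)
Lemma ideal_gens S f : ideal_gen (fun g => g \in gens S) f <-> IA f.
Proof.
split; apply: ideal_gen_sub => g.
  by move=> /mem_gens[k ->]; apply: gen_toric.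
move=> [u [v [/degA_deg eq_uv ->]]].
have [u' std_u [eq_u redu]] := standard_reduction S u.
have [v' std_v [eq_v redv]] := standard_reduction S v.
have eq_uv' : u' = v'.
  have [_ anti _ _ _] := le_wt_term_order S.
  by apply: anti; rewrite !standard_min // -eq_u -eq_v eq_uv.
have -> : binom K u v = binom K u u' + - binom K v v'.
  by rewrite eq_uv' opprB addrA subrK.
by apply: ideal_genD => //; apply: ideal_genN.
Qed.

Lemma lead_gen S k : lead_mon (le_wt S) (gen S k) (lm S k).
Proof.
have [tot _ _ _ _] := le_wt_term_order S.
split=> [|v]; rewrite mem_msupp_binom ?lm_neq_tm ?eqxx //.
case/orP => /eqP->; first by have := tot (lm S k) (lm S k); rewrite orbb.
by rewrite /le_wt /weight_order weight_tm weight_lm.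
Qed.

Lemma lead_uniq S f u v :
  lead_mon (le_wt S) f u -> lead_mon (le_wt S) f v -> u = v.
Proof.
have [_ anti _ _ _] := le_wt_term_order S.
by move=> [fu leu] [fv lev]; apply: anti; rewrite leu // lev.
Qed.

(* The image of [f] in degree [deg u] is the sum of the coefficients of [f]
   over the fibre of [u], which a standard leading monomial [u] would reduce
   to its own coefficient. *)
Lemma lead_toric S f u :
  IA f -> lead_mon (le_wt S) f u -> exists k, (lm S k <= u)%MM.
Proof.
move=> If [fu le_u]; apply/existsP; apply: contraLR fu.
rewrite negb_exists => /forallP std_u; rewrite -mcoeff_eq0; apply/eqP.
have [_ anti _ _ _] := le_wt_term_order S.
have := congr1 (mcoeff (deg u)) (toric_phi If).
rewrite mcoeff0 {1}[f]mpolyE rmorph_sum raddf_sum /= => <-.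
(* Another such [v] would be below [u], which is leading, and above [u], which is standard. *)
have fiber v : v \in msupp f -> v != u -> deg v != deg u.
  move=> fv; apply: contra => /eqP eq_deg; apply/eqP; apply: anti.
  by rewrite le_u // standard_min.
have phiZ c v : (phi (c *: 'X_[v]))@_(deg u) = c * (deg v == deg u)%:R.
  by rewrite /phi /= mmapZ mcoeffCM -mcoeffX -phiX.
have [fu|nfu] := boolP (u \in msupp f).
  rewrite (bigD1_seq u) ?msupp_uniq //= phiZ eqxx mulr1 big1_seq ?addr0 //.
  by move=> v /andP[vu fv]; rewrite phiZ (negbTE (fiber v fv vu)) mulr0.
rewrite memN_msupp_eq0 // big1_seq // => v /andP[_ fv]; rewrite phiZ.
by rewrite (negbTE (fiber v fv _)) ?mulr0 //; apply: contraNneq nfu => <-.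
Qed.

Lemma gens_reduced S : reduced_groebner_basis (le_wt S) IA (gens S).
Proof.
split; first split.
- by move=> g /mem_gens[k ->]; apply: gen_toric.
- move=> f; split; apply: ideal_gen_sub => h [g [u [Gg lead_u ->]]]; last first.
    have [k lm_u] := lead_toric Gg lead_u.
    rewrite -(submK lm_u) mpolyXD; apply/ideal_genMl/ideal_gen_base.
    exists (gen S k), (lm S k); split=> //; last exact: lead_gen.
    by apply/mem_gens; exists k.
  apply: ideal_gen_base; exists g, u; split=> //.
  by case/mem_gens: Gg => k ->; apply: gen_toric.
- move=> g /mem_gens[k ->]; exists (lm S k); first exact: lead_gen.
  rewrite mcoeffB !mcoeffX eqxx [_ == lm S k]eq_sym.
  by rewrite (negbTE (lm_neq_tm S k)) subr0.
move=> g h u v /mem_gens[k ->] /mem_gens[k' ->] neq_g lead_u.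
have {u lead_u} -> := lead_uniq lead_u (lead_gen S k').
rewrite mem_msupp_binom ?lm_neq_tm // lm_dvd -ltnNge.
case/orP => /eqP->; last by rewrite tm_lvar lexp_gt0.
have [eq_k|neq_k] := eqVneq k k'; first by rewrite eq_k eqxx in neq_g.
by rewrite lm_lvar (negbTE neq_k) lexp_gt0.
Qed.

Lemma universal_gen S k : universal_groebner_basis (K := K) conf (gen S k).
Proof.
exists (le_wt S), (gens S); split; first exact: le_wt_term_order.
  exact: gens_reduced.
by apply/mem_gens; exists k.
Qed.

(* The point at which these variables are zero and the other ones are one is
   a common zero of all the [gen S k'] with [k' <> k], but not of [gen S k]. *)
Definition zeros S k : {set 'I_m} :=
  tvar |: (if k is Some i then [set var i (i \notin S)] else set0).

Lemma forall_zeros S k u :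
  [forall j in zeros S k, u j == 0%N]
    = (u tvar == 0%N)
      && (if k is Some i then u (var i (i \notin S)) == 0%N else true).
Proof.
apply/forall_inP/andP => [u0|[ut uk] j].
  by split; [|case: k u0 => // i u0]; apply: u0; rewrite !inE eqxx ?orbT.
by case: k uk => [i|] uk; rewrite !inE ?orbF; [case/orP|]; move/eqP->.
Qed.

(** For [k' = Some j], the zeroed variable [var j (j \notin S)] divides [tail S]; as [t] is zeroed
    too, [gen S None] vanishes. *)
Lemma gen_zeros S k k' :
  ((gen S k).@[fun j => (j \notin zeros S k')%:R] == 0) = (k != k').
Proof.
rewrite mevalB !meval_indicator !forall_zeros.
case: k k' => [i|] [j|] /=; rewrite ?mulmnE ?mnm1E ?tail_var ?tail_tvar;
  rewrite ?eq_var ?eq_var_tvar ?eqxx ?andbF ?subrr ?sub0r ?oppr_eq0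
    ?oner_eq0 ?eqxx //.
  rewrite (inj_eq Some_inj).
  case: (eqVneq i j) => [->|_] /=; last by rewrite subrr eqxx.
  by case: (j \in S); rewrite subr0 oner_eq0.
by case: (j \notin S); rewrite eqxx.
Qed.

Lemma gen_inj S : injective (gen S).
Proof.
move=> k k' eq_gen; apply/eqP; rewrite -[_ == _]negbK -(gen_zeros S) eq_gen.
by rewrite gen_zeros eqxx.
Qed.

Lemma gens_markov S : markov_basis conf (gens S).
Proof.
split; first by rewrite map_inj_uniq ?enum_uniq //; apply: gen_inj.
- by move=> f /mem_gens[k ->]; exists (lm S k), (tm S k); rewrite lm_neq_tm.
- exact: ideal_gens.
move=> M sub_M genM f /mem_gens[k ->]; apply: contraT => notM.
have /genM := gen_toric S k.
move=> /(ideal_gen_ker (phi := meval (fun j => (j \notin zeros S k)%:R))) ev0.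
have := gen_zeros S k k; rewrite ev0 ?eqxx // => g Mg.
have /mem_gens[k' gE] := sub_M g Mg; apply/eqP; rewrite gE gen_zeros.
by apply: contraNneq notM => <-; rewrite -gE.
Qed.

Lemma size_gens S : size (gens S) = N.+1.
Proof. by rewrite size_map -cardE card_option card_ord. Qed.

(** * The exponentially many binomials linear in [t] *)

Notation long S := (gen S None).

Lemma lm_None S : lm S None = U_(tvar)%MM.
Proof. by apply/mnmP => j; rewrite mulmnE muln1. Qed.

Lemma long_irreducible S : irreducible_elt (long S).
Proof. by rewrite /gen lm_None; apply/irreducible_binom_linear/tail_tvar. Qed.

(** A binomial dividing termwise has first term [t ^ e] with [e <= 1]; the degrees force its second
    term to be the [e]-th power of the tail, and [e = 0] would give zero. *)
Lemma long_primitive S : graver_basis (K := K) conf (long S).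
Proof.
exists (lm S None), (tail S); split=> //; split.
- exact: long_irreducible.
- exact: gen_toric.
move=> w z neq_wz /toric_binom/deg_eq eq_deg.
move=> /lem_var[le_wt le_wv] /lem_var[le_zt le_zv].
move: le_wt le_zt; rewrite lm_None mnm1E eqxx tail_tvar => le_wt le_zt.
have wv i b : w (var i b) = 0%N.
  by have := le_wv i b; rewrite lm_None mnm1E eq_tvar_var; lia.
have zv i b : z (var i b) = (w tvar * tail S (var i b))%N.
  have := eq_deg i; have := le_zv i b; have := le_zv i (~~ b).
  by rewrite !wv !tail_var; case: (i \in S); case: b => /=; lia.
have [w0|w1] : w tvar = 0%N \/ w tvar = 1%N by lia.
  by case/eqP: neq_wz; apply: eq_mnm_var => [|i b]; rewrite ?wv ?zv w0; lia.
congr (binom K _ _); apply: eq_mnm_var => [|i b].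
- by rewrite w1 mnm1E eqxx.
- by rewrite wv mnm1E eq_tvar_var.
- by rewrite tail_tvar; lia.
- by rewrite zv w1 mul1n.
Qed.

(** Besides [t], the support offers one variable per coordinate. Equal exponents of [t] would thus
    force [w = z]; unequal ones must be balanced in every coordinate, which uses the whole
    support. *)
Lemma long_circuit S : circuit (K := K) conf (long S).
Proof.
split.
- by exists (lm S None), (tm S None); rewrite lm_neq_tm.
- exact: long_irreducible.
- exact: gen_toric.
move=> _ [w [z [neq_wz ->]]] /toric_binom/deg_eq eq_deg; apply/negP.
case/properP => /subsetP sub_supp [j]; rewrite !mem_psupp_binom ?lm_neq_tm //.
have off i : w (var i (i \in S)) = 0%N /\ z (var i (i \in S)) = 0%N.
  have := sub_supp (var i (i \in S)); rewrite !mem_psupp_binom ?lm_neq_tm //.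
  rewrite lm_None mnm1E eq_tvar_var /= tail_var.
  by case: (i \in S) => /=; lia.
have neq_t : w tvar != z tvar.
  apply: contraNneq neq_wz => eq_t; apply/eqP/eq_mnm_var => // i b.
  have := eq_deg i; have := off i; rewrite eq_t.
  by case: (i \in S); case: b; lia.
elim/var_ind: j => [_|i b]; first by lia.
rewrite lm_None mnm1E eq_tvar_var /= tail_var.
have := eq_deg i; have := off i; move: neq_t.
by case: (i \in S); case: b => /=; lia.
Qed.

(** The set of monomials ignores signs; its only member free of [t] is [tail S], whose exponent at
    [var i false] tells whether [i] is in [S]. *)
Lemma long_pairwise :
  pairwise (fun f g => (f != g) && (f != - g)) [seq long A | A : {set 'I_N}].
Proof.
rewrite pairwise_map.
apply: sub_pairwise (_ : pairwise [rel A B | A != B] _); last first.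
  by rewrite -uniq_pairwise enum_uniq.
move=> S S' /=; rewrite -negb_or; apply: contra => eq_long.
have eq_supp : msupp (long S) =i msupp (long S').
  by case/orP: eq_long => /eqP-> // u; rewrite (perm_mem (msuppN _)).
have := eq_supp (tail S); rewrite !mem_msupp_binom ?lm_neq_tm //.
rewrite eqxx orbT !lm_None.
case/esym/orP => /eqP eq_tail.
  have := congr1 (fun u : 'X_{1..m} => u tvar) eq_tail.
  by rewrite tail_tvar mnm1E eqxx.
apply/eqP/setP => i.
have := congr1 (fun u : 'X_{1..m} => u (var i false)) eq_tail.
by rewrite !tail_var; case: (i \in S); case: (i \in S').
Qed.

Lemma long_count (R : realType) (r : R) (P : {mpoly K[m]} -> Prop) :
  (forall S, P (long S)) -> r < (2 ^ N)%:R -> card_up_to_sign_gt P r.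
Proof.
move=> Plong lt_r; exists [seq long A | A : {set 'I_N}]; split.
- by move=> f /codomP[S ->].
- exact: long_pairwise.
by rewrite size_map -cardE -cardsT -powersetT card_powerset cardsT card_ord.
Qed.

End Configuration.

(** * Exponential against polynomial growth *)

Lemma polynomial_lt_exp2 (R : realType) (p : {poly R}) :
  exists N : nat, p.[N.+1%:R] < (2 ^ N)%:R.
Proof.
pose c := \sum_(i < size p) `|p`_i|; pose d := size p.
have [C ltC] : exists C : nat, c < (2 ^ C)%:R.
  exists (Num.bound c); apply: lt_trans (archi_boundP _) _.
    by apply: sumr_ge0 => i _.
  by rewrite ltr_nat ltn_expl.
(* Here [N + 1 = 4 ^ k], so all bounds are powers of two; it remains to see [C + 2 * k * d < 4 ^ k],
   and [k] is large enough for [(k + 1) ^ 2 <= 4 ^ k] to give this. *)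
pose k := (C + 2 * d).+1; exists (2 ^ (2 * k)).-1.
rewrite prednK ?expn_gt0 //.
have bound_p x : 1 <= x -> p.[x] <= c * x ^+ d.
  move=> x1; rewrite horner_coef mulr_suml; apply: ler_sum => i _.
  apply: le_trans (ler_norm _) _; rewrite normrM ler_wpM2l // normrX.
  rewrite ger0_norm ?(le_trans ler01) // ler_weXn2l //.
  exact: ltnW.
apply: le_lt_trans (bound_p _ _) _; first by rewrite ler1n expn_gt0.
rewrite natrX -exprM -natrX; apply: (@lt_le_trans _ _ (2 ^ (C + 2 * k * d))%:R).
  by rewrite expnD natrM ltr_pM2r // ltr0n expn_gt0.
rewrite ler_nat leq_pexp2l //.
have : (k.+1 * k.+1 <= 2 ^ (2 * k))%N.
  by rewrite mul2n -addnn expnD leq_mul // ltn_expl.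
rewrite /k; nia.
Qed.

Theorem theorem3p1 (R : realType) (K : fieldType) (p : {poly R}) :
  exists (n m : nat) (a : 'I_m -> 'rV[int]_n) (M : seq {mpoly K[m]}),
    [/\ injective a /\ (forall i j, 0 <= a i 0 j),
        markov_basis a M,
        card_up_to_sign_gt (circuit (K := K) a) p.[(size M)%:R],
        card_up_to_sign_gt (universal_groebner_basis (K := K) a)
          p.[(size M)%:R]
      & card_up_to_sign_gt (graver_basis (K := K) a) p.[(size M)%:R]].
Proof.
have [N lt_p] := polynomial_lt_exp2 p.
(* For [setT] the basis consists of the [f_i^2 - d_i^3] and [t - prod_i d_i^3]. *)
exists N, #|{: option ('I_N * bool)}|, (@conf N), (gens K setT).
rewrite size_gens; split.
- by split; [apply: conf_inj | apply: conf_ge0].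
- exact: gens_markov.
- by apply: long_count lt_p; apply: long_circuit.
- by apply: long_count lt_p => S; apply: universal_gen.
- by apply: long_count lt_p; apply: long_primitive.
Qed.
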